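(* Let $n$ be a positive integer and let $VP_n^+$ be the abstract group presented by generators $\lambda_{i,j}$ for $1\le i<j\le n$ and relations $$\lambda_{i,j}\lambda_{k,l}=\lambda_{k,l}\lambda_{i,j}\quad\text{for } i<j,\ k<l,\ i,j,k,l \text{ distinct},$$ $$\lambda_{k,i}(\lambda_{k,j}\lambda_{i,j})=(\lambda_{i,j}\lambda_{k,j})\lambda_{k,i}\quad\text{for } k<i<j.$$ Then $VP_n^+$ coincides with the subgroup of the virtual pure braid group $VP_n$ generated by the set $\{\lambda_{i,j}\mid 1\le i<j\le n\}$ (that is, sending each generator $\lambda_{i,j}$ to the element $\lambda_{i,j}\in VP_n$ defines an isomorphism of $VP_n^+$ onto this subgroup), and $VP_n^+$ is isomorphic to the flat virtual pure braid group $FVP_n$.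
   Context: The virtual braid group $VB_n$ is the group with generators $\sigma_1,\dots,\sigma_{n-1},\rho_1,\dots,\rho_{n-1}$ and defining relations: (R1) $\sigma_i\sigma_{i+1}\sigma_i=\sigma_{i+1}\sigma_i\sigma_{i+1}$ for $1\le i\le n-2$; (R2) $\sigma_i\sigma_j=\sigma_j\sigma_i$ for $|i-j|\ge 2$; (R3) $\rho_i\rho_{i+1}\rho_i=\rho_{i+1}\rho_i\rho_{i+1}$ for $1\le i\le n-2$; (R4) $\rho_i\rho_j=\rho_j\rho_i$ for $|i-j|\ge 2$; (R5) $\rho_i^2=1$ for $1\le i\le n-1$; (R6) $\sigma_i\rho_j=\rho_j\sigma_i$ for $|i-j|\ge 2$; (M) $\rho_i\rho_{i+1}\sigma_i=\sigma_{i+1}\rho_i\rho_{i+1}$ for $1\le i\le n-2$. The virtual pure braid group $VP_n$ is the kernel of the homomorphism $VB_n\to S_n$ sending both $\sigma_i$ and $\rho_i$ to $(i,i+1)$. The elements $\lambda_{k,l}\in VP_n$ are defined as follows. For $1\le i\le n-1$: $\lambda_{i,i+1}=\rho_i\sigma_i^{-1}$ and $\lambda_{i+1,i}=\rho_i\lambda_{i,i+1}\rho_i=\sigma_i^{-1}\rho_i$. For $1\le i<j-1\le n-1$: $\lambda_{i,j}=\rho_{j-1}\rho_{j-2}\cdots\rho_{i+1}\,\lambda_{i,i+1}\,\rho_{i+1}\cdots\rho_{j-2}\rho_{j-1}$ and $\lambda_{j,i}=\rho_{j-1}\rho_{j-2}\cdots\rho_{i+1}\,\lambda_{i+1,i}\,\rho_{i+1}\cdots\rho_{j-2}\rho_{j-1}$.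 The flat virtual braid group $FVB_n$ is the quotient of $VB_n$ by the relations $\sigma_i^2=1$ for $1\le i\le n-1$; the image of $\sigma_i$ is denoted $s_i$ and the image of $\rho_i$ is still denoted $\rho_i$. The flat virtual pure braid group $FVP_n$ is the kernel of the homomorphism $FVB_n\to S_n$ sending both $s_i$ and $\rho_i$ to $(i,i+1)$. *)

(* Defs.v *)
From HB Require Import structures.
From mathcomp Require Import all_boot all_fingroup.
From mathcomp Require Import boolp classical_sets.
From mathcomp Require Import zify.

Set Implicit Arguments.
Unset Strict Implicit.
Unset Printing Implicit Defensive.

Local Open Scope quotient_scope.
Local Open Scope group_scope.

(* fingroup's repr, for sets, shadows the one for quotient types. *)
Local Notation repr := generic_quotient.repr.

(* Words in the letters x (encoded as (x, false)) and x^-1 (as (x, true)),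
   under concatenation and formal inversion; inverse letters are not
   cancelled, so this is only a monoid with involution. *)
Definition word (T : Type) := seq (T * bool).

Definition letter (T : Type) (x : T) : word T := [:: (x, false)].

Section WordTheory.
Variable T : choiceType.

HB.instance Definition _ := Choice.on (word T).

Definition word_mul (u v : word T) : word T := u ++ v.
Definition word_inv (u : word T) : word T := rev [seq (a.1, ~~ a.2) | a <- u].

Fact word_mulA : associative word_mul. Proof. exact: catA. Qed.
Fact word_mul1 : left_id [::] word_mul. Proof. by []. Qed.
Fact word_invK : involutive word_inv.
Proof.
move=> u; rewrite /word_inv map_rev revK -map_comp map_id_in // => -[x b] _ /=.
by rewrite negbK.
Qed.
Fact word_invM : {morph word_inv : u v / word_mul u v >-> word_mul v u}.
Proof. by move=> u v; rewrite /word_inv map_cat rev_cat. Qed.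

HB.instance Definition _ :=
  isStarMonoid.Build (word T) word_mulA word_mul1 word_invK word_invM.

Definition word_eval (H : groupType) (h : T -> H) (u : word T) : H :=
  \prod_(a <- u) (if a.2 then (h a.1)^-1 else h a.1).

Variables (H : groupType) (h : T -> H).

Lemma word_eval_letter x : word_eval h (letter x) = h x.
Proof. by rewrite /word_eval big_seq1. Qed.

Lemma word_evalM : {morph word_eval h : u v / u * v >-> u * v}.
Proof. by move=> u v; rewrite /word_eval big_cat. Qed.

Lemma word_evalV : {morph word_eval h : u / u^-1 >-> u^-1}.
Proof.
elim=> [|[x b] u IHu]; first by rewrite /word_eval !big_nil invg1.
rewrite -[(x, b) :: u]/(([:: (x, b)] : word T) * u) invgM !word_evalM invgM IHu.
by rewrite /word_eval !big_seq1 /=; case: b => /=; rewrite ?invgK.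
Qed.

End WordTheory.

(* The quotient group of M by the relations u = v for R u v.  M may be a group,
   or a monoid of words, for which the quotient by R is the group presented
   by R; the constructor for u * u^-1 is what makes the latter a group. *)
Section GroupQuotient.
Variables (M : starMonoidType) (R : M -> M -> Prop).

Inductive group_cong : M -> M -> Prop :=
| cong_rel u v of R u v : group_cong u v
| cong_inv u : group_cong (u * u^-1) 1
| cong_mul u u' v v' of group_cong u u' & group_cong v v' :
    group_cong (u * v) (u' * v')
| cong_refl u : group_cong u u
| cong_sym u v of group_cong u v : group_cong v u
| cong_trans u v w of group_cong u v & group_cong v w : group_cong u w.

Definition group_congb (u v : M) : bool := `[< group_cong u v >].

Fact group_congb_refl : reflexive group_congb.
Proof. by move=> u; apply/asboolP/cong_refl. Qed.
Fact group_congb_sym : symmetric group_congb.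
Proof. by move=> u v; apply/asboolP/asboolP => /cong_sym. Qed.
Fact group_congb_trans : transitive group_congb.
Proof. by move=> v u w /asboolP uv /asboolP vw; apply/asboolP/(cong_trans uv). Qed.

Canonical group_cong_equiv :=
  EquivRel group_congb group_congb_refl group_congb_sym group_congb_trans.

Definition group_quot := {eq_quot group_cong_equiv}.
HB.instance Definition _ := Choice.on group_quot.

Definition quot_pi (u : M) : group_quot := \pi_group_quot u.

Lemma quot_piP u v : quot_pi u = quot_pi v <-> group_cong u v.
Proof.
split=> [/eqmodP/asboolP // | uv].
by apply/eqmodP/asboolP.
Qed.

Lemma quot_pi_repr (x : group_quot) : quot_pi (repr x) = x.
Proof. exact: reprK. Qed.

Lemma quot_ind (P : group_quot -> Prop) : (forall u, P (quot_pi u)) -> forall x, P x.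
Proof. by move=> Ppi x; rewrite -(quot_pi_repr x). Qed.

Lemma group_cong_inv u v : group_cong u v -> group_cong u^-1 v^-1.
Proof.
move=> uv; have Vu (w : M) : group_cong (w^-1 * w) 1.
  by have := cong_inv w^-1; rewrite invgK.
have := cong_mul (cong_refl u^-1) (cong_inv v); rewrite mulg1 => /cong_sym e1.
apply: cong_trans e1 _; rewrite mulgA.
apply: (@cong_trans _ (u^-1 * u * v^-1)).
  by apply: cong_mul; [apply: cong_mul (cong_refl _) (cong_sym uv) | apply: cong_refl].
by have := cong_mul (Vu u) (cong_refl v^-1); rewrite mul1g.
Qed.

Definition quot_mul (x y : group_quot) : group_quot := quot_pi (repr x * repr y).
Definition quot_one : group_quot := quot_pi 1.
Definition quot_inv (x : group_quot) : group_quot := quot_pi (repr x)^-1.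

Lemma repr_pi_cong u : group_cong (repr (quot_pi u)) u.
Proof. by apply/quot_piP; rewrite quot_pi_repr. Qed.

Lemma quot_mulE u v : quot_mul (quot_pi u) (quot_pi v) = quot_pi (u * v).
Proof. by apply/quot_piP/cong_mul; apply: repr_pi_cong. Qed.

Lemma quot_invE u : quot_inv (quot_pi u) = quot_pi u^-1.
Proof. exact/quot_piP/group_cong_inv/repr_pi_cong. Qed.

Fact quot_mulA : associative quot_mul.
Proof.
by elim/quot_ind=> u; elim/quot_ind=> v; elim/quot_ind=> w; rewrite !quot_mulE mulgA.
Qed.
Fact quot_mul1g : left_id quot_one quot_mul.
Proof. by elim/quot_ind=> u; rewrite quot_mulE mul1g. Qed.
Fact quot_mulg1 : right_id quot_one quot_mul.
Proof. by elim/quot_ind=> u; rewrite quot_mulE mulg1. Qed.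
Fact quot_mulgV : right_inverse quot_one quot_inv quot_mul.
Proof.
by elim/quot_ind=> u; rewrite quot_invE quot_mulE; apply/quot_piP/cong_inv.
Qed.
Fact quot_mulVg : left_inverse quot_one quot_inv quot_mul.
Proof.
elim/quot_ind=> u; rewrite quot_invE quot_mulE; apply/quot_piP.
by have := cong_inv u^-1; rewrite invgK.
Qed.

HB.instance Definition _ := isGroup.Build group_quot
  quot_mulA quot_mul1g quot_mulg1 quot_mulVg quot_mulgV.

Lemma quot_pi1 : quot_pi 1 = 1. Proof. by []. Qed.
Fact quot_piM : {morph quot_pi : u v / u * v >-> u * v}.
Proof. by move=> u v; rewrite -quot_mulE. Qed.
Lemma quot_piV : {morph quot_pi : u / u^-1 >-> u^-1}.
Proof. by move=> u; rewrite -quot_invE. Qed.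

HB.instance Definition _ := isMultiplicative.Build M group_quot quot_pi quot_piM.

Section Lift.
Variables (H : groupType) (f : M -> H).
Hypothesis fM : {morph f : u v / u * v >-> u * v}.
Hypothesis fV : {morph f : u / u^-1 >-> u^-1}.
Hypothesis fR : forall u v, R u v -> f u = f v.

Definition quot_lift (x : group_quot) : H := f (repr x).

Lemma quot_lift_cong u v : group_cong u v -> f u = f v.
Proof.
have f1 : f 1 = 1 by apply: (@mulgI _ (f 1)); rewrite -fM !mulg1.
elim=> {u v} [u v /fR //|u|u u' v v' _ e1 _ e2|//|u v _ -> //|u v w _ -> _ -> //].
  by rewrite fM fV mulgV f1.
by rewrite !fM e1 e2.
Qed.

Lemma quot_liftE u : quot_lift (quot_pi u) = f u.
Proof. exact/quot_lift_cong/repr_pi_cong. Qed.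

Lemma quot_liftM : {morph quot_lift : x y / x * y >-> x * y}.
Proof.
by elim/quot_ind=> u; elim/quot_ind=> v; rewrite -quot_piM !quot_liftE fM.
Qed.
End Lift.

End GroupQuotient.

Section Kernel.
Variables (G H : groupType) (f : {multiplicative G -> H}).

Definition ker_pred : {pred G} := fun x => f x == 1.

Record ker := Ker { ker_val : G; _ : ker_val \in ker_pred }.

HB.instance Definition _ := [isSub for ker_val].
HB.instance Definition _ := [Choice of ker by <:].

Fact ker_closed : group_closed ker_pred.
Proof.
have f1 : f 1 = 1 by apply: (@mulgI _ (f 1)); rewrite -gmulfM !mulg1.
split=> [|x y]; rewrite ?unfold_in /ker_pred ?f1 // => /eqP fx /eqP fy.
apply/eqP/(@mulIg _ (f y)).
by rewrite -gmulfM mulgVK fx fy mulg1.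
Qed.

HB.instance Definition _ := SubChoice_isSubGroup.Build G ker_pred ker ker_closed.
End Kernel.

Definition is_subgroup (G : groupType) (S : set G) : Prop :=
  S 1 /\ (forall x y, S x -> S y -> S (x * y^-1)).

Definition subgroup_generated (G : groupType) (A : set G) : set G :=
  smallest (@is_subgroup G) A.

(* Indices start at 0: the element i of 'I_n.-1 stands for the subscript i + 1
   of a generator of VB_n, and exchanges the points i and i + 1 of 'I_n. *)
Section VirtualBraid.
Variable n : nat.

Lemma ltn_pred_l (i : 'I_n.-1) : i < n.
Proof. by rewrite (leq_trans (ltn_ord i)) ?leq_pred. Qed.
Lemma ltn_pred_r (i : 'I_n.-1) : i.+1 < n.
Proof. by case: n i => [|m] []. Qed.

Definition adj_tperm (i : 'I_n.-1) : 'S_n :=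
  tperm (Ordinal (ltn_pred_l i)) (Ordinal (ltn_pred_r i)).

Definition VB_gen : choiceType := ('I_n.-1 + 'I_n.-1)%type.
Definition sigma_letter (i : 'I_n.-1) : word VB_gen := letter (inl i : VB_gen).
Definition rho_letter (i : 'I_n.-1) : word VB_gen := letter (inr i : VB_gen).

Definition far (i j : 'I_n.-1) : bool := (i.+1 < j) || (j.+1 < i).

Local Notation sg := sigma_letter.
Local Notation rh := rho_letter.

Inductive VB_rel : word VB_gen -> word VB_gen -> Prop :=
| VB_R1 (i j : 'I_n.-1) of j = i.+1 :> nat : VB_rel (sg i * sg j * sg i) (sg j * sg i * sg j)
| VB_R2 (i j : 'I_n.-1) of far i j : VB_rel (sg i * sg j) (sg j * sg i)
| VB_R3 (i j : 'I_n.-1) of j = i.+1 :> nat : VB_rel (rh i * rh j * rh i) (rh j * rh i * rh j)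
| VB_R4 (i j : 'I_n.-1) of far i j : VB_rel (rh i * rh j) (rh j * rh i)
| VB_R5 i : VB_rel (rh i * rh i) 1
| VB_R6 (i j : 'I_n.-1) of far i j : VB_rel (sg i * rh j) (rh j * sg i)
| VB_M (i j : 'I_n.-1) of j = i.+1 :> nat : VB_rel (rh i * rh j * sg i) (sg j * rh i * rh j).

Definition VB : groupType := group_quot VB_rel.

Definition sigma (i : 'I_n.-1) : VB := quot_pi VB_rel (sigma_letter i).
Definition rho (i : 'I_n.-1) : VB := quot_pi VB_rel (rho_letter i).

Definition word_perm : word VB_gen -> 'S_n :=
  word_eval (fun a : VB_gen =>
    match a with inl i => adj_tperm i | inr i => adj_tperm i end).

Definition VB_perm (x : VB) : 'S_n := quot_lift word_perm x.

Lemma adj_tperm_far i j : far i j -> commute (adj_tperm i) (adj_tperm j).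
Proof.
rewrite /far => ij; apply/esym/commgP/conjg_fixP; rewrite /adj_tperm tpermJ.
by rewrite !tpermD // -val_eqE /=; apply: contraTneq ij; lia.
Qed.

Lemma adj_tperm_braid (i j : 'I_n.-1) : j = i.+1 :> nat ->
  adj_tperm i * adj_tperm j * adj_tperm i = adj_tperm j * adj_tperm i * adj_tperm j.
Proof.
move=> ji; rewrite /adj_tperm.
have -> : Ordinal (ltn_pred_r i) = Ordinal (ltn_pred_l j) by apply: val_inj; rewrite /= ji.
set a := Ordinal _; set b := Ordinal _; set c := Ordinal _.
have ab : a != b by rewrite -val_eqE /=; lia.
have bc : b != c by rewrite -val_eqE /=; lia.
have ac : a != c by rewrite -val_eqE /=; lia.
have -> : tperm a b * tperm b c * tperm a b = tperm b c ^ tperm a b.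
  by rewrite /conjg tpermV mulgA.
have -> : tperm b c * tperm a b * tperm b c = tperm a b ^ tperm b c.
  by rewrite /conjg tpermV mulgA.
by rewrite !tpermJ tpermR tpermL !tpermD // 1?eq_sym.
Qed.

Fact word_permM : {morph word_perm : u v / u * v >-> u * v}.
Proof. exact: word_evalM. Qed.
Fact word_permV : {morph word_perm : u / u^-1 >-> u^-1}.
Proof. exact: word_evalV. Qed.
Lemma word_perm_letter (i : 'I_n.-1) :
  (word_perm (sigma_letter i) = adj_tperm i) *
  (word_perm (rho_letter i) = adj_tperm i).
Proof. by split; apply: word_eval_letter. Qed.

Fact word_perm_rel u v : VB_rel u v -> word_perm u = word_perm v.
Proof.
case=> {u v} [i j ij|i j ij|i j ij|i j ij|i|i j ij|i j ij].
- by rewrite !word_permM !word_perm_letter adj_tperm_braid.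
- by rewrite !word_permM !word_perm_letter adj_tperm_far.
- by rewrite !word_permM !word_perm_letter adj_tperm_braid.
- by rewrite !word_permM !word_perm_letter adj_tperm_far.
- rewrite word_permM !word_perm_letter.
  by rewrite /adj_tperm -{1}tpermV mulVg [in RHS]/word_perm /word_eval big_nil.
- by rewrite !word_permM !word_perm_letter adj_tperm_far.
- by rewrite !word_permM !word_perm_letter adj_tperm_braid.
Qed.

Fact VB_permM : {morph VB_perm : x y / x * y >-> x * y}.
Proof.
by apply: quot_liftM => [||u v /word_perm_rel]; [exact: word_permM | exact: word_permV |].
Qed.

HB.instance Definition _ := isMultiplicative.Build VB 'S_n VB_perm VB_permM.

Lemma VB_perm1 : VB_perm 1 = 1.
Proof. by apply: (@mulgI _ (VB_perm 1)); rewrite -VB_permM !mulg1. Qed.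

Lemma VB_permV : {morph VB_perm : x / x^-1 >-> x^-1}.
Proof. by move=> x; apply: (@mulgI _ (VB_perm x)); rewrite -VB_permM !mulgV VB_perm1. Qed.

Lemma VB_perm_sigma i : VB_perm (sigma i) = adj_tperm i.
Proof.
by rewrite /VB_perm quot_liftE ?word_perm_letter //;
  [exact: word_permM | exact: word_permV | exact: word_perm_rel].
Qed.

Lemma VB_perm_rho i : VB_perm (rho i) = adj_tperm i.
Proof.
by rewrite /VB_perm quot_liftE ?word_perm_letter //;
  [exact: word_permM | exact: word_permV | exact: word_perm_rel].
Qed.

Definition VP : groupType := ker VB_perm.

Lemma ltn_pred_lt (i j : 'I_n) : i < j -> i < n.-1.
Proof. by move=> ij; have := ltn_ord j; lia. Qed.

Definition lambda_adj (i : 'I_n.-1) : VB := rho i * (sigma i)^-1.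

(* For j = i + 1 both products are empty. *)
Definition lambda_VB (i j : 'I_n) (ij : i < j) : VB :=
  (\prod_(k <- rev (enum 'I_n.-1) | i < k < j) rho k)
  * lambda_adj (Ordinal (ltn_pred_lt ij))
  * (\prod_(k <- enum 'I_n.-1 | i < k < j) rho k).

Fact lambda_VB_ker (i j : 'I_n) (ij : i < j) : lambda_VB ij \in ker_pred VB_perm.
Proof.
have Vprod (s : seq 'I_n.-1) : VB_perm ((\prod_(k <- rev s | i < k < j) rho k)
    * (\prod_(k <- s | i < k < j) rho k)) = 1.
  elim: s => [|k s IHs]; first by rewrite !big_nil mulg1 VB_perm1.
  rewrite rev_cons -cats1 big_cat !big_cons big_nil /=.
  case: ifP => _; rewrite mulg1 // -mulgA (mulgA (rho k)) !VB_permM VB_perm_rho.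
  by rewrite /adj_tperm tperm2 mul1g -VB_permM.
rewrite unfold_in /ker_pred /= /lambda_VB /lambda_adj; apply/eqP.
by rewrite !VB_permM VB_permV VB_perm_rho VB_perm_sigma mulgV mulg1 -VB_permM.
Qed.

Definition lambda (i j : 'I_n) (ij : i < j) : VP := Ker (lambda_VB_ker ij).

Inductive flat_rel : VB -> VB -> Prop :=
| flat_sigma i : flat_rel (sigma i * sigma i) 1.

Definition FVB : groupType := group_quot flat_rel.

Definition FVB_perm (x : FVB) : 'S_n := quot_lift VB_perm x.

Fact VB_perm_flat x y : flat_rel x y -> VB_perm x = VB_perm y.
Proof.
case=> i; rewrite VB_permM VB_perm_sigma /adj_tperm -{1}tpermV mulVg.
by rewrite VB_perm1.
Qed.

Fact FVB_permM : {morph FVB_perm : x y / x * y >-> x * y}.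
Proof. exact: quot_liftM VB_permM VB_permV VB_perm_flat. Qed.

HB.instance Definition _ := isMultiplicative.Build FVB 'S_n FVB_perm FVB_permM.

Lemma FVB_perm_pi (x : VB) : FVB_perm (quot_pi flat_rel x) = VB_perm x.
Proof. exact: quot_liftE VB_permM VB_permV VB_perm_flat x. Qed.

Definition FVP : groupType := ker FVB_perm.

Definition VPplus_gen : choiceType := {p : 'I_n * 'I_n | p.1 < p.2}.

Definition VPplus_letter (i j : 'I_n) (ij : i < j) : VPplus_gen :=
  exist (fun p : 'I_n * 'I_n => p.1 < p.2) (i, j) ij.

Definition lambda_letter (i j : 'I_n) (ij : i < j) : word VPplus_gen := letter (VPplus_letter ij).

Local Notation lm := lambda_letter.

Inductive VPplus_rel : word VPplus_gen -> word VPplus_gen -> Prop :=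
| VPplus_comm (i j k l : 'I_n) (ij : i < j) (kl : k < l) of uniq [:: i; j; k; l] :
    VPplus_rel (lm ij * lm kl) (lm kl * lm ij)
| VPplus_braid (k i j : 'I_n) (ki : k < i) (ij : i < j) (kj : k < j) :
    VPplus_rel (lm ki * (lm kj * lm ij)) ((lm ij * lm kj) * lm ki).

Definition VPplus : groupType := group_quot VPplus_rel.

Definition lambda_plus (i j : 'I_n) (ij : i < j) : VPplus :=
  quot_pi VPplus_rel (lambda_letter ij).

End VirtualBraid.

(* Main.v *)
Require Import Defs.
From HB Require Import structures.
From mathcomp Require Import all_boot all_fingroup.
From mathcomp Require Import boolp classical_sets.
From mathcomp Require Import zify.

(* Write lambda_{ji} = lambda_{ij}^-1 in VP_n^+ for i < j. The relations of
   VP_n^+ then hold for all distinct indices, so S_n acts on VP_n^+ by permuting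
   indices, and sigma_i |-> (lambda_{i+1,i}, (i,i+1)), rho_i |-> (1, (i,i+1))
   defines a homomorphism theta from VB_n to the semidirect product of VP_n^+ by
   S_n, which kills sigma_i^2. In VB_n, conjugation by rho_k permutes the indices
   of the lambda_{ij}; this reduces the relations of VP_n^+ to special
   positions of the indices, and yields a homomorphism from VP_n^+ to VP_n. Since
   theta maps lambda_{ij} to (lambda_{ij}, 1), it is injective, even after
   passing to FVB_n. It is onto FVP_n: every element of FVB_n is the product of an
   element of the image and a word in the rho_k, and such a word is trivial as
   soon as its permutation is (the Coxeter presentation of S_n). *)

Set Implicit Arguments.
Unset Strict Implicit.
Unset Printing Implicit Defensive.

Local Open Scope group_scope.
Local Open Scope classical_set_scope.

(** * Groups presented by generators and relations *)

Section MulMorph.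
Variables (G H : groupType) (f : G -> H).
Hypothesis fM : {morph f : x y / x * y}.

Lemma mulmorph1 : f 1 = 1.
Proof. by apply: (@mulgI _ (f 1)); rewrite -fM !mulg1. Qed.

Lemma mulmorphV : {morph f : x / x^-1}.
Proof. by move=> x; apply: (@mulgI _ (f x)); rewrite -fM !mulgV mulmorph1. Qed.

End MulMorph.

Section PresentedGroup.
Variables (T : choiceType) (R : word T -> word T -> Prop).

(** A representing word is peeled off letter by letter from the left; an inverted letter is the
    formal inverse of a one-letter word. *)
Lemma presented_ind (P : group_quot R -> Prop) : P 1 ->
    (forall t x, P x -> P (quot_pi R (letter t) * x)) ->
    (forall t x, P x -> P ((quot_pi R (letter t))^-1 * x)) ->
  forall x, P x.
Proof.
move=> P1 Pl PV; elim/quot_ind; elim=> [|[t b] u IHu]; first exact: P1.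
rewrite -[(t, b) :: u]/(([:: (t, b)] : word T) * u) quot_piM.
case: b; last exact: Pl.
by rewrite -[[:: _]]/((letter t)^-1) quot_piV; apply: PV.
Qed.

Lemma presented_hom_eq (H : groupType) (f g : group_quot R -> H) :
    {morph f : x y / x * y} -> {morph g : x y / x * y} ->
    (forall t, f (quot_pi R (letter t)) = g (quot_pi R (letter t))) ->
  f =1 g.
Proof.
move=> fM gM fg.
elim/presented_ind=> [|t x IHx|t x IHx]; first by rewrite (mulmorph1 fM) (mulmorph1 gM).
  by rewrite fM gM IHx fg.
by rewrite fM gM (mulmorphV fM) (mulmorphV gM) IHx fg.
Qed.

Section Lift.
Variables (H : groupType) (h : T -> H).
Hypothesis hR : forall u v, R u v -> word_eval h u = word_eval h v.

Lemma presented_liftM : {morph quot_lift (R := R) (word_eval h) : x y / x * y}.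
Proof. exact: quot_liftM (@word_evalM _ _ h) (@word_evalV _ _ h) hR. Qed.

Lemma presented_liftE t : quot_lift (word_eval h) (quot_pi R (letter t)) = h t.
Proof.
by rewrite (quot_liftE (@word_evalM _ _ h) (@word_evalV _ _ h) hR) word_eval_letter.
Qed.

End Lift.
End PresentedGroup.

(** * The relations of $VB_n$, with generators indexed by natural numbers *)

Section VirtualBraidGroup.
Variable n : nat.
Local Notation VB := (VB n).

(* The value 1 out of range makes the far commutation relations unconditional. *)
Definition rhon (k : nat) : VB := oapp (@rho n) 1 (insub k).
Definition sigman (k : nat) : VB := oapp (@sigma n) 1 (insub k).

Lemma rhonE (i : 'I_n.-1) : rhon i = rho i. Proof. by rewrite /rhon valK. Qed.
Lemma sigmanE (i : 'I_n.-1) : sigman i = sigma i. Proof. by rewrite /sigman valK. Qed.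

Lemma VB_relE u v : VB_rel u v -> quot_pi (@VB_rel n) u = quot_pi (@VB_rel n) v.
Proof. by move=> uv; apply/quot_piP/cong_rel. Qed.

Lemma rhon_sq k : rhon k * rhon k = 1.
Proof.
rewrite /rhon; case: insubP => [i _ _|_] /=; last by rewrite mulg1.
by have /VB_relE := VB_R5 i; rewrite quot_piM.
Qed.

Lemma rhonV k : (rhon k)^-1 = rhon k.
Proof. by apply: (@mulgI _ (rhon k)); rewrite mulgV rhon_sq. Qed.

Lemma rhon_far i j : i.+1 < j -> commute (rhon i) (rhon j).
Proof.
rewrite /rhon => ij; case: insubP => [i' _ Di|_] /=; last exact/commute_sym/commute1.
case: insubP => [j' _ Dj|_] /=; last exact/commute1.
have /VB_R4/VB_relE : far i' j' by rewrite /far Di Dj ij.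
by rewrite !quot_piM.
Qed.

Lemma sigman_far i j : i.+1 < j -> commute (sigman i) (sigman j).
Proof.
rewrite /sigman => ij; case: insubP => [i' _ Di|_] /=; last exact/commute_sym/commute1.
case: insubP => [j' _ Dj|_] /=; last exact/commute1.
have /VB_R2/VB_relE : far i' j' by rewrite /far Di Dj ij.
by rewrite !quot_piM.
Qed.

Lemma sigman_rhon_far i j : (i.+1 < j) || (j.+1 < i) -> commute (sigman i) (rhon j).
Proof.
rewrite /sigman /rhon => ij.
case: insubP => [i' _ Di|_] /=; last exact/commute_sym/commute1.
case: insubP => [j' _ Dj|_] /=; last exact/commute1.
have /VB_R6/VB_relE : far i' j' by rewrite /far Di Dj ij.
by rewrite !quot_piM.
Qed.

Lemma rhon_braid i : i.+1 < n.-1 ->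
  rhon i * rhon i.+1 * rhon i = rhon i.+1 * rhon i * rhon i.+1.
Proof.
move=> lin; have ltin := ltnW lin.
have /VB_R3/VB_relE : Ordinal lin = (Ordinal ltin).+1 :> nat by [].
by rewrite !quot_piM -![quot_pi _ _]/(rho _) -!rhonE.
Qed.

Lemma sigman_braid i : i.+1 < n.-1 ->
  sigman i * sigman i.+1 * sigman i = sigman i.+1 * sigman i * sigman i.+1.
Proof.
move=> lin; have ltin := ltnW lin.
have /VB_R1/VB_relE : Ordinal lin = (Ordinal ltin).+1 :> nat by [].
by rewrite !quot_piM -![quot_pi _ _]/(sigma _) -!sigmanE.
Qed.

Lemma rhon_sigman_mixed i : i.+1 < n.-1 ->
  rhon i * rhon i.+1 * sigman i = sigman i.+1 * rhon i * rhon i.+1.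
Proof.
move=> lin; have ltin := ltnW lin.
have /VB_M/VB_relE : Ordinal lin = (Ordinal ltin).+1 :> nat by [].
by rewrite !quot_piM -[quot_pi _ (sigma_letter _)]/(sigma _)
  -[quot_pi _ (sigma_letter (Ordinal lin))]/(sigma _)
  -![quot_pi _ (rho_letter _)]/(rho _) -!sigmanE -!rhonE.
Qed.
End VirtualBraidGroup.

(** * Conjugation of the lambda's by the rho's *)

(** This is the braid relation of $VP_n^+$ for the indices $a,a+1,a+2$, with $x=\rho_a$,
    $y=\rho_{a+1}$, $u=\sigma_a^{-1}$, $v=\sigma_{a+1}^{-1}$. The mixed relation, also in the form
    [u * y * x = y * x * v], brings one side to $xyx\cdot vuv$ and the other to $yxy\cdot uvu$. *)
Lemma triple_base (G : groupType) (x y u v : G) :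
    x * x = 1 -> y * y = 1 -> x * y * x = y * x * y -> u * v * u = v * u * v ->
    v * x * y = x * y * u ->
  x * u * (y * (x * u * y) * (y * v)) = y * v * (y * (x * u * y)) * (x * u).
Proof.
move=> xx yy xyx uvu vxy.
have uyx : u * y * x = y * x * v.
  have : y * x * (v * x * y) * (y * x) = y * x * (x * y * u) * (y * x) by rewrite vxy.
  rewrite -!mulgA (mulgA y y) yy mul1g xx mulg1 (mulgA x x) xx mul1g.
  by rewrite (mulgA y y) yy mul1g.
have -> : x * u * (y * (x * u * y) * (y * v)) = x * (u * y * x) * u * v.
  by rewrite -!mulgA (mulgA y y) yy mul1g.
have -> : y * v * (y * (x * u * y)) * (x * u) = y * v * y * x * (u * y * x) * u.
  by rewrite !mulgA.
rewrite uyx.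
have -> : y * v * y * x * (y * x * v) * u = y * v * (y * x * y) * x * v * u.
  by rewrite !mulgA.
rewrite -xyx; have -> : y * v * (x * y * x) * x * v * u = y * (v * x * y) * v * u.
  by rewrite -!mulgA (mulgA x x) xx mul1g.
rewrite vxy; have -> : y * (x * y * u) * v * u = y * x * y * (u * v * u).
  by rewrite !mulgA.
by rewrite uvu -xyx !mulgA.
Qed.

Section Lambda.
Variable n : nat.
Local Notation VB := (VB n).
Local Notation rhon := (@rhon n).
Local Notation sigman := (@sigman n).

(* lamd i d is lambda_{i, i+d+1}. *)
Fixpoint lamd (i d : nat) : VB :=
  if d is d'.+1 then lamd i d' ^ rhon (i + d) else rhon i * (sigman i)^-1.

Definition lamn (i j : nat) : VB := lamd i (j - i.+1).

Lemma conj_rhonK k : involutive (conjg^~ (rhon k) : VB -> VB).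
Proof. by move=> x /=; rewrite -conjgM rhon_sq conjg1. Qed.

Lemma conj_fix (x y : VB) : commute x y -> x ^ y = x.
Proof. by move=> xy; rewrite conjgE xy mulKg. Qed.

Lemma conj_rhonC (x : VB) i j : i.+1 < j -> (x ^ rhon i) ^ rhon j = (x ^ rhon j) ^ rhon i.
Proof. by move=> ij; rewrite -!conjgM (rhon_far n ij). Qed.

Lemma conj_rhon_braid (x : VB) i : i.+1 < n.-1 ->
  ((x ^ rhon i) ^ rhon i.+1) ^ rhon i = ((x ^ rhon i.+1) ^ rhon i) ^ rhon i.+1.
Proof. by move=> lin; rewrite -!conjgM !mulgA rhon_braid. Qed.

Lemma lamd_far i d k : (k.+1 < i) || ((i + d).+1 < k) -> lamd i d ^ rhon k = lamd i d.
Proof.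
elim: d => [|d IHd] /= ik.
  rewrite addn0 in ik; apply/conj_fix/commute_sym/commuteM.
    by case/orP: ik => ik; [apply: rhon_far | apply/commute_sym/rhon_far].
  by apply/commuteV/commute_sym/sigman_rhon_far; rewrite orbC.
case/orP: ik => ik; last by rewrite conj_rhonC ?IHd //; lia.
by rewrite -conj_rhonC ?IHd //; lia.
Qed.

Lemma lamd_inner i d k : i + d < n.-1 -> i < k < i + d -> lamd i d ^ rhon k = lamd i d.
Proof.
elim: d => [|d IHd] /= idn ikd; first lia.
have [kd | kd] := ltnP k (i + d); first by rewrite -conj_rhonC ?IHd //; lia.
have {kd} Dk : k = i + d by lia.
case: d => [|d] in IHd idn ikd Dk *; first lia.
(* Here the last two conjugations are by [rhon k] and [rhon k.+1]. By the braid relation,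
   [rhon k.+1] can be made to act first on [lamd i d], which it fixes. *)
rewrite /= (addnS i d.+1) -[i + d.+1]Dk conj_rhon_braid; last lia.
by rewrite (@lamd_far i d k.+1) //; lia.
Qed.

(** For [d = 0] this is the mixed relation, solved for $\sigma_{i+1}^{-1}$; for larger [d] the
    outermost conjugation commutes with the one by [rhon i]. *)
Lemma lamd_left i d : (i + d).+1 < n.-1 -> lamd i.+1 d ^ rhon i = lamd i d.+1.
Proof.
elim: d => [|d IHd] idn.
  rewrite /= addn1 !conjgE !rhonV.
  have rrV : (rhon i * rhon i.+1)^-1 = rhon i.+1 * rhon i by rewrite invgM !rhonV.
  have -> : (sigman i.+1)^-1 = rhon i * rhon i.+1 * (sigman i)^-1 * (rhon i.+1 * rhon i).
    rewrite -rrV; apply: invg_inj; rewrite invgK !invgM !invgK -[RHS]mulgA -invgM rrV.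
    rewrite !mulgA rhon_sigman_mixed; last lia.
    by rewrite -!mulgA (mulgA (rhon i.+1) (rhon i.+1)) rhon_sq mul1g rhon_sq mulg1.
  rewrite !mulgA -(mulgA _ (rhon i) (rhon i)) rhon_sq mulg1.
  rewrite rhon_braid; last lia.
  by rewrite -!mulgA (mulgA (rhon i.+1) (rhon i.+1)) rhon_sq mul1g.
rewrite [lamd i.+1 _]/= -conj_rhonC; last lia.
by rewrite IHd; [rewrite /= addSnnS | lia].
Qed.

Definition swapn (k i : nat) : nat :=
  if i == k then k.+1 else if i == k.+1 then k else i.

Lemma swapnL k : swapn k k = k.+1. Proof. by rewrite /swapn eqxx. Qed.

Lemma swapnR k : swapn k k.+1 = k. Proof. by rewrite /swapn eqxx ifF //; lia. Qed.

Lemma swapnD k i : i != k -> i != k.+1 -> swapn k i = i.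
Proof. by rewrite /swapn => /negPf-> /negPf->. Qed.

(** The excluded pair would give $\lambda_{k+1,k}$, which is not a value of [lamn] at increasing
    indices; any other pair stays increasing under the transposition. The cases are whether $k$ or
    $k+1$ is one of the two indices, and if not, whether [k] lies inside or outside the interval. *)
Lemma lamn_conj i j k : i < j < n -> k < n.-1 -> (i, j) != (k, k.+1) ->
  lamn i j ^ rhon k = lamn (swapn k i) (swapn k j).
Proof.
rewrite xpair_eqE /swapn => ijn kn nij.
have [d Dj] : exists d, j = i + d.+1 by exists (j - i.+1); lia.
rewrite {}Dj in ijn nij *.
have lamdE a b e : b = a + e.+1 -> lamd a e = lamn a b.
  by rewrite /lamn => ->; congr lamd; lia.
rewrite -(lamdE i _ d) //.
case: (eqVneq i k) => [Di | nik].
  subst k; rewrite eqxx /= in nij *.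
  case: d => [|d] in ijn nij *; first lia.
  rewrite !ifF; [|lia..].
  by rewrite -lamd_left ?conj_rhonK; [apply: lamdE; lia | lia].
case: (eqVneq i k.+1) => [Di | nik'].
  subst i; rewrite !ifF; [|lia..].
  by rewrite lamd_left; [apply: lamdE; lia | lia].
case: (eqVneq (i + d.+1) k) => [Dk | njk].
  rewrite -(lamdE i _ d.+1); last lia.
  by rewrite /= Dk.
case: (eqVneq (i + d.+1) k.+1) => [Dk | njk'].
  case: d => [|d] in ijn nij njk Dk *; first lia.
  have -> : k = i + d.+1 by lia.
  by rewrite /= conj_rhonK; apply: lamdE; lia.
rewrite -(lamdE i _ d) //.
case: (boolP (i < k < i + d)) => ikd; first by apply: lamd_inner => //; lia.
by apply: lamd_far; lia.
Qed.

(** Conjugation by the $\rho_p$ reduces everything to three consecutive indices: from there the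
    largest index is moved to the right, then the smallest one to the left. *)
Lemma lamn_triple i j k : i < j < k -> k < n ->
  lamn i j * (lamn i k * lamn j k) = (lamn j k * lamn i k) * lamn i j.
Proof.
pose P i j k := lamn i j * (lamn i k * lamn j k) = (lamn j k * lamn i k) * lamn i j.
rewrite -[_ = _]/(P i j k) => ijk kn.
(* Since [b] lies strictly between [a] and [c], the pair [(a, c)] is never [(p, p.+1)]. *)
have Pconj a b c p : a < b < c -> c < n -> p < n.-1 -> (a, b) != (p, p.+1) ->
    (b, c) != (p, p.+1) -> P a b c -> P (swapn p a) (swapn p b) (swapn p c).
  move=> abc cn pn ab bc /(congr1 (conjg^~ (rhon p))).
  by rewrite /P !conjMg !lamn_conj ?xpair_eqE //; move: ab bc; rewrite ?xpair_eqE; lia.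
have Pbase a : a.+2 < n -> P a a.+1 a.+2.
  move=> an.
  have Vbraid : (sigman a)^-1 * (sigman a.+1)^-1 * (sigman a)^-1 =
      (sigman a.+1)^-1 * (sigman a)^-1 * (sigman a.+1)^-1.
    by rewrite -!invgM !mulgA sigman_braid //; lia.
  have Vmixed : (sigman a.+1)^-1 * rhon a * rhon a.+1 = rhon a * rhon a.+1 * (sigman a)^-1.
    apply: (@mulIg _ (sigman a)); rewrite mulgVK -!mulgA (mulgA (rhon a)).
    by rewrite rhon_sigman_mixed ?mulgA ?mulVg ?mul1g //; lia.
  rewrite /P {2 5}/lamn subSS subSnn [lamd a 1]/= addn1 conjgE rhonV /lamn !subnn /=.
  by apply: triple_base; rewrite ?rhon_sq ?rhon_braid //; lia.
have Pright a e : (a + e).+2 < n -> P a a.+1 (a + e).+2.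
  elim: e => [|e IHe] ae; first by rewrite addn0; apply: Pbase; lia.
  have := Pconj a a.+1 (a + e).+2 (a + e).+2.
  rewrite swapnL !swapnD ?addnS; [|lia..].
  by apply; last (apply: IHe); rewrite ?xpair_eqE; lia.
have Pleft e : e < j -> P (j - e.+1) j k.
  elim: e => [|e IHe] ej.
    have kE : (j.-1 + (k - j.+1)).+2 = k by lia.
    have := Pright j.-1 (k - j.+1); rewrite kE prednK ?subn1; last lia.
    exact.
  have := Pconj (j - e.+1) j k (j - e.+2).
  have ->: swapn (j - e.+2) (j - e.+1) = j - e.+2.
    by rewrite [in LHS](_ : j - e.+1 = (j - e.+2).+1) ?swapnR //; lia.
  rewrite !swapnD; [|lia..].
  by apply; last (apply: IHe); rewrite ?xpair_eqE; lia.
have -> : i = j - (j - i.+1).+1 by lia.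
by apply: Pleft; lia.
Qed.

Lemma lamd_commute x i d : (forall t, i <= t <= i + d -> commute x (rhon t)) ->
  commute x (sigman i) -> commute x (lamd i d).
Proof.
move=> xr xs; elim: d => [|d IHd] in xr *.
  by apply: commuteM; [apply: xr; lia | apply: commuteV].
rewrite /= conjgE rhonV; do 2?apply: commuteM; try (apply: xr; lia).
by apply: IHd => t it; apply: xr; lia.
Qed.

(** Two intervals are disjoint, crossing or nested. Disjoint ones commute by the far relations;
    conjugation by a suitable $\rho_p$ makes disjoint intervals cross and crossing ones nest, and
    then moves the right end [b] of the first further out. *)
Lemma lamn_commute i j k l : i < j < n -> k < l < n -> uniq [:: i; j; k; l] ->
  commute (lamn i j) (lamn k l).
Proof.
have Pconj a b c d p : a < b < n -> c < d < n -> p < n.-1 -> (a, b) != (p, p.+1) ->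
    (c, d) != (p, p.+1) -> commute (lamn a b) (lamn c d) ->
    commute (lamn (swapn p a) (swapn p b)) (lamn (swapn p c) (swapn p d)).
  move=> ab cd pn nab ncd /(congr1 (conjg^~ (rhon p))).
  by rewrite !conjMg !lamn_conj.
have Pdisj a b c d : a < b < c -> c < d < n -> commute (lamn a b) (lamn c d).
  move=> abc cdn.
  apply/commute_sym/lamd_commute => [t abt|].
    by apply/commgP/conjg_fixP; rewrite lamd_far //; lia.
  apply/commute_sym/lamd_commute => [t cdt|].
    by apply: sigman_rhon_far; lia.
  by apply: sigman_far; lia.
have Pcross a b c d : a < c < b -> b < d < n -> commute (lamn a b) (lamn c d).
  move=> acb bdn; have [e Db] : exists e, b = c.+1 + e by exists (b - c.+1); lia.
  elim: e b Db acb bdn => [|e IHe] b Db acb bdn.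
    have := Pconj a c b d c; rewrite Db addn0 swapnL swapnR !swapnD; [|lia..].
    by apply; last (apply: Pdisj); rewrite ?xpair_eqE; lia.
  have := Pconj a b.-1 c d b.-1; rewrite swapnL prednK ?swapnD; [|lia..].
  by apply; last (apply: IHe); rewrite ?xpair_eqE; lia.
have Pnest a b c d : a < c -> c < d < b -> b < n -> commute (lamn a b) (lamn c d).
  move=> ac cdb bn; have [e Db] : exists e, b = d.+1 + e by exists (b - d.+1); lia.
  elim: e b Db cdb bn => [|e IHe] b Db cdb bn.
    have := Pconj a d c b d; rewrite Db addn0 swapnL swapnR !swapnD; [|lia..].
    by apply; last (apply: Pcross); rewrite ?xpair_eqE; lia.
  have := Pconj a b.-1 c d b.-1; rewrite swapnL prednK ?swapnD; [|lia..].
  by apply; last (apply: IHe); rewrite ?xpair_eqE; lia.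
wlog ik : i j k l / i < k.
  move=> IH ij kl ijkl; case: (ltngtP i k) => [ik | ki | Dik]; first exact: IH.
    by apply/commute_sym/IH => //; move: ijkl; rewrite /= !inE; lia.
  by move: ijkl; rewrite /= !inE Dik eqxx orbT.
move=> ij kl; rewrite /= !inE => ijkl.
case: (ltnP j k) => jk; first by apply: Pdisj; lia.
case: (ltnP j l) => jl; first by apply: Pcross; lia.
by apply: Pnest; lia.
Qed.
End Lambda.

(** * The subgroup generated by the rho's *)

Section Coxeter.
Variable n : nat.
Local Notation VB := (VB n).
Local Notation rhon := (@rhon n).

(** The filtered products run over the interval from $i+1$ to $j-1$, and each further factor
    $\rho_k$ on both sides is one more conjugation, because $\rho_k^{-1}=\rho_k$. *)
Lemma lambda_VBE (i j : 'I_n) (ij : i < j) : lambda_VB ij = lamn n i j.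
Proof.
have filterE : [seq k <- iota 0 n.-1 | i < k < j] = iota i.+1 (j - i.+1).
  apply: (irr_sorted_eq ltn_trans ltnn); rewrite ?iota_ltn_sorted //.
    by rewrite sorted_filter ?iota_ltn_sorted //; apply: ltn_trans.
  by move=> k; have := ltn_ord j; rewrite mem_filter !mem_iota; lia.
have prodE (s : seq 'I_n.-1) :
    \prod_(k <- s | i < k < j) rho k = \prod_(k <- [seq k <- map val s | i < k < j]) rhon k.
  by rewrite big_filter big_map; apply: eq_bigr => k _; rewrite rhonE.
rewrite /lambda_VB !prodE map_rev filter_rev val_enum_ord filterE /lamn /lambda_adj.
rewrite -rhonE -sigmanE /=.
elim: (j - i.+1) => [|d IHd]; first by rewrite !big_nil mulg1 mul1g.
rewrite (_ : iota _ d.+1 = iota i.+1 d ++ iota (i.+1 + d) 1); last by rewrite -iotaD addn1.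
rewrite rev_cat !big_cat !big_seq1 /= addSnnS -IHd conjgE rhonV.
by rewrite !mulgA.
Qed.

Definition rho_prod (s : seq nat) : VB := \prod_(k <- s) rhon k.

(** This is $\rho_{k+d-1}\cdots\rho_{k+1}\rho_k$, whose permutation sends the point $k+d$ to $k$. *)
Fixpoint rho_desc (k d : nat) : VB := if d is d'.+1 then rhon (k + d') * rho_desc k d' else 1.

Lemma rho_descSl k d : rho_desc k d.+1 = rho_desc k.+1 d * rhon k.
Proof.
elim: d => [|d IHd]; first by rewrite /= addn0 mulg1 mul1g.
by rewrite [LHS]/= -/(rho_desc k d.+1) IHd mulgA /= addSnnS.
Qed.

Lemma rho_desc_far k d j : (j.+1 < k) || (k + d < j) -> commute (rho_desc k d) (rhon j).
Proof.
elim: d => [|d IHd] /= kj; first exact/commute_sym/commute1.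
apply/commute_sym/commuteM; last by apply/commute_sym/IHd; lia.
by case/orP: kj => kj; [apply: rhon_far | apply/commute_sym/rhon_far]; lia.
Qed.

(** The factors to the right of $\rho_{j+1}\rho_j$ in the descending product commute with
    $\rho_{j+1}$, those to the left commute with $\rho_j$, and in between the braid relation
    applies. *)
Lemma rho_desc_shift k d j : k + d <= n.-1 -> k <= j -> j.+1 < k + d ->
  rho_desc k d * rhon j.+1 = rhon j * rho_desc k d.
Proof.
elim: d => [|d IHd] kdn kj jkd; first lia.
have [jd | jd] := ltnP j.+1 (k + d).
  rewrite /= -mulgA IHd //; last lia.
  by rewrite !mulgA (rhon_far n jd).
case: d => [|d] in IHd kdn jkd jd *; first lia.
have -> : rho_desc k d.+2 = rhon j.+1 * (rhon j * rho_desc k d).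
  by rewrite /=; congr (rhon _ * (rhon _ * _)); lia.
rewrite -!mulgA rho_desc_far; last lia.
by rewrite !mulgA rhon_braid //; lia.
Qed.

(* The rho_desc k (m + 1 - k) represent the cosets of <rho_0, .., rho_{m-1}> in
   <rho_0, .., rho_m>. *)
Lemma rho_prod_normal m s : m < n.-1 -> all (leq^~ m) s ->
  exists s' k, [/\ all (ltn^~ m) s', k <= m.+1
                 & rho_prod s = rho_prod s' * rho_desc k (m.+1 - k)].
Proof.
move=> mn; elim/last_ind: s => [_ | s j IHs].
  by exists [::], m.+1; rewrite subnn /rho_prod big_nil /= mulg1.
rewrite all_rcons => /andP[jm /IHs[s' [k [s'm km es]]]].
rewrite /rho_prod -cats1 big_cat big_seq1 /= -/(rho_prod s) es -mulgA.
(* The new letter [rhon j] on the right passes into the prefix if [j.+1 < k], prolongs the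
   descending product if [j.+1 = k], enters the prefix with its index lowered by one if [k < j], and
   cancels the last factor if [j = k]. *)
case: (ltngtP j k) => [jk | kj | jk].
- have [jk'|jk'] := ltnP j.+1 k.
    exists (rcons s' j), k; rewrite all_rcons s'm; split=> //; first lia.
    rewrite rho_desc_far; last lia.
    by rewrite /rho_prod -cats1 big_cat big_seq1 /= mulgA.
  exists s', j; split=> //; first lia.
  have -> : k = j.+1 by lia.
  by rewrite subSS -rho_descSl subSn.
- case: j jm kj => // j jm kj.
  exists (rcons s' j), k; rewrite all_rcons s'm; split=> //; first lia.
  rewrite rho_desc_shift; [|lia..].
  by rewrite /rho_prod -cats1 big_cat big_seq1 /= mulgA.
exists s', j.+1; split=> //.
by rewrite -jk subSn // rho_descSl -mulgA rhon_sq mulg1 subSS.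
Qed.

Lemma adj_tpermE (k : 'I_n.-1) (x : 'I_n) : adj_tperm k x = swapn k x :> nat.
Proof.
rewrite /adj_tperm /swapn; case: tpermP => [->|->|] /=; rewrite ?eqxx //.
  by rewrite ifF //; lia.
by move=> /eqP nk /eqP nk'; rewrite !ifN.
Qed.

Lemma VB_perm_rhon k (x : 'I_n) : k < n.-1 -> VB_perm (rhon k) x = swapn k x :> nat.
Proof.
by move=> kn; have -> : k = Ordinal kn by []; rewrite rhonE VB_perm_rho adj_tpermE.
Qed.

Lemma rho_prod_fix m s (x : 'I_n) : m <= n.-1 -> all (ltn^~ m) s -> m < x ->
  VB_perm (rho_prod s) x = x.
Proof.
move=> mn + mx; elim: s => [_|k s IHs] /=; first by rewrite /rho_prod big_nil VB_perm1 perm1.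
case/andP=> km sm; rewrite /rho_prod big_cons VB_permM permM -/(rho_prod s).
rewrite (_ : VB_perm _ x = x) ?IHs //.
by apply: val_inj; rewrite /= VB_perm_rhon ?swapnD //; lia.
Qed.

Lemma VB_perm_rho_desc k d (x : 'I_n) : x = k + d :> nat ->
  VB_perm (rho_desc k d) x = k :> nat.
Proof.
elim: d x => [|d IHd] x Dx /=; first by rewrite VB_perm1 perm1 Dx addn0.
have xn := ltn_ord x.
rewrite VB_permM permM; apply: IHd; rewrite VB_perm_rhon; last lia.
by rewrite Dx addnS swapnR.
Qed.

(** Induction on a bound [m] for the letters. In the normal form the prefix fixes the top point
    $m+1$ and the descending product sends it to [k]; hence $k=m+1$, the descending product is
    empty, and the bound drops. *)
Lemma rho_prod_perm1 s : all (ltn^~ n.-1) s -> VB_perm (rho_prod s) = 1 -> rho_prod s = 1.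
Proof.
have: n.-1 <= n.-1 by []; elim: {1 3}n.-1 s => [|m IHm] s mn sm s1.
  by case: s sm {s1} => //; rewrite /rho_prod big_nil.
have [s' [k [s'm km es]]] := rho_prod_normal mn sm.
have xn : m.+1 < n by lia.
have := congr1 (fun p : 'S_n => p (Ordinal xn) : nat) s1.
rewrite es VB_permM permM (rho_prod_fix _ s'm) ?perm1; [|by rewrite /=; lia..].
rewrite (@VB_perm_rho_desc k); last by rewrite /=; lia.
move=> Dk; move: s1; rewrite es Dk /= subnn mulg1; apply: IHm => //.
exact: ltnW.
Qed.
End Coxeter.

(** * The semidirect product of VPplus by the symmetric group *)

(** With $x=\lambda_{ki}$, $y=\lambda_{kj}$, $z=\lambda_{ij}$, inverting $x$ amounts to exchanging
    the indices $k$ and $i$ in the braid relation. *)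
Lemma braid_invl (G : groupType) (x y z : G) :
  x * y * z = z * y * x -> x^-1 * z * y = y * z * x^-1.
Proof.
move=> e; apply: (@mulgI _ x); apply: (@mulIg _ x).
by rewrite !mulgA mulgV mul1g mulgVK -e.
Qed.

Lemma braid_invr (G : groupType) (x y z : G) :
  x * y * z = z * y * x -> y * x * z^-1 = z^-1 * x * y.
Proof. by move=> e; apply/esym/braid_invl. Qed.

Section FlatModel.
Variable n : nat.
Local Notation VPplus := (VPplus n).

Definition lambda0 (i j : 'I_n) : VPplus :=
  oapp (fun p : VPplus_gen n => quot_pi (@VPplus_rel n) (letter p)) 1
    (insub (i, j) : option {p : 'I_n * 'I_n | p.1 < p.2}).

(* lambda_{ij} if i < j, the inverse of lambda_{ji} if j < i, as the factor that is
   out of range is 1. *)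
Definition lambda2 (i j : 'I_n) : VPplus := lambda0 i j * (lambda0 j i)^-1.

Lemma lambda2V i j : (lambda2 i j)^-1 = lambda2 j i.
Proof. by rewrite /lambda2 invgM invgK. Qed.

Lemma lambda2E (i j : 'I_n) (ij : i < j) : lambda2 i j = lambda_plus ij.
Proof.
rewrite /lambda2 /lambda0 (@insubT _ (fun p : 'I_n * 'I_n => p.1 < p.2) _ (i, j) ij) /=.
by rewrite insubN ?invg1 ?mulg1 //= -leqNgt ltnW.
Qed.

Lemma lambda2_commute i j k l : uniq [:: i; j; k; l] -> commute (lambda2 i j) (lambda2 k l).
Proof.
have comm_lt (a b c d : 'I_n) : a < b -> c < d -> uniq [:: a; b; c; d] ->
    commute (lambda2 a b) (lambda2 c d).
  move=> ab cd abcd; rewrite (lambda2E ab) (lambda2E cd).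
  by have /cong_rel/quot_piP := VPplus_comm ab cd abcd; rewrite !quot_piM.
have comm_l (a b c d : 'I_n) : a < b -> uniq [:: a; b; c; d] ->
    commute (lambda2 a b) (lambda2 c d).
  move=> ab abcd; case: (ltngtP c d) => [cd | dc | /val_inj Dcd]; first exact: comm_lt.
    rewrite -(lambda2V d c); apply/commuteV/comm_lt => //.
    by move: abcd; rewrite /= !inE (eq_sym c d) !negb_or; do !case: (_ == _).
  by move: abcd; rewrite /= !inE Dcd eqxx !andbF.
move=> ijkl; case: (ltngtP i j) => [ij | ji | /val_inj Dij]; first exact: comm_l.
  rewrite -(lambda2V j i); apply/commute_sym/commuteV/commute_sym/comm_l => //.
  by move: ijkl; rewrite /= !inE (eq_sym i j) !negb_or; do !case: (_ == _).
by move: ijkl; rewrite /= !inE Dij eqxx.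
Qed.

(** The defining relation covers increasing indices; the exchanges [Pl] and [Pr] of neighbouring
    indices carry it to the other five orders. *)
Lemma lambda2_braid k i j : uniq [:: k; i; j] ->
  lambda2 k i * (lambda2 k j * lambda2 i j) = (lambda2 i j * lambda2 k j) * lambda2 k i.
Proof.
pose P k i j := lambda2 k i * lambda2 k j * lambda2 i j = lambda2 i j * lambda2 k j * lambda2 k i.
rewrite mulgA -[_ = _]/(P k i j).
have Plt (a b c : 'I_n) : a < b -> b < c -> P a b c.
  move=> ab bc; have ac := ltn_trans ab bc.
  rewrite /P (lambda2E ab) (lambda2E bc) (lambda2E ac).
  by have /cong_rel/quot_piP := VPplus_braid ab bc ac; rewrite !quot_piM mulgA.
have Pl a b c : P a b c -> P b a c.
  by rewrite /P -(lambda2V a b); apply: braid_invl.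
have Pr a b c : P a b c -> P a c b.
  by rewrite /P -(lambda2V b c); apply: braid_invr.
rewrite /= !inE negb_or andbT => /andP[/andP[ki kj] ij].
move: ki kj ij; rewrite -!val_eqE !neq_ltn.
case/orP=> ki; case/orP=> kj; case/orP=> ij.
- exact: Plt.
- exact/Pr/Plt.
- by lia.
- exact/Pr/Pl/Plt.
- exact/Pl/Plt.
- by lia.
- exact/Pl/Pr/Plt.
- exact/Pl/Pr/Pl/Plt.
Qed.

Definition perm_gen (s : 'S_n) (p : VPplus_gen n) : VPplus :=
  lambda2 (s (val p).1) (s (val p).2).

Definition perm_act (s : 'S_n) : VPplus -> VPplus := quot_lift (word_eval (perm_gen s)).

(** A permutation destroys the order of the indices but keeps them distinct, which is all that the
    relations between the [lambda2] require. *)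
Lemma perm_gen_rel s u v : VPplus_rel u v -> word_eval (perm_gen s) u = word_eval (perm_gen s) v.
Proof.
case=> [i j k l ij kl ijkl | k i j ki ij kj].
  rewrite !word_evalM !word_eval_letter; apply: lambda2_commute.
  by rewrite -[[:: _; _; _; _]]/(map s [:: i; j; k; l]) map_inj_uniq //; apply: perm_inj.
rewrite !word_evalM !word_eval_letter; apply: lambda2_braid.
rewrite -[[:: _; _; _]]/(map s [:: k; i; j]) map_inj_uniq; last exact: perm_inj.
by rewrite /= !inE -!val_eqE /=; lia.
Qed.

Lemma perm_actM s : {morph perm_act s : x y / x * y}.
Proof. exact: presented_liftM (@perm_gen_rel s). Qed.

Lemma perm_act1 s : perm_act s 1 = 1.
Proof. exact: mulmorph1 (perm_actM s). Qed.

Lemma perm_actV s : {morph perm_act s : x / x^-1}.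
Proof. exact: mulmorphV (perm_actM s). Qed.

Lemma perm_act_lambda2 s i j : perm_act s (lambda2 i j) = lambda2 (s i) (s j).
Proof.
have act_lt (a b : 'I_n) : a < b -> perm_act s (lambda2 a b) = lambda2 (s a) (s b).
  by move=> ab; rewrite (lambda2E ab); apply: presented_liftE (@perm_gen_rel s) _.
case: (ltngtP i j) => [| ji | /val_inj ->]; first exact: act_lt.
  by rewrite -lambda2V perm_actV act_lt ?lambda2V.
by rewrite /lambda2 !mulgV perm_act1.
Qed.

Lemma VPplus_hom_eq (H : groupType) (f g : VPplus -> H) :
    {morph f : x y / x * y} -> {morph g : x y / x * y} ->
    (forall (i j : 'I_n) (ij : i < j), f (lambda_plus ij) = g (lambda_plus ij)) ->
  f =1 g.
Proof. by move=> fM gM fg; apply: presented_hom_eq fM gM _ => -[[i j] ij]; apply: fg. Qed.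

Lemma perm_act_id x : perm_act 1 x = x.
Proof.
move: x; apply: (@VPplus_hom_eq _ (perm_act 1) id) => // [|i j ij]; first exact: perm_actM.
by rewrite -lambda2E perm_act_lambda2 !perm1.
Qed.

Lemma perm_actA s t x : perm_act (s * t) x = perm_act t (perm_act s x).
Proof.
move: x; apply: (@VPplus_hom_eq _ (perm_act (s * t)) (perm_act t \o perm_act s)) => [||i j ij].
- exact: perm_actM.
- by move=> x y /=; rewrite !perm_actM.
by rewrite -lambda2E /= !perm_act_lambda2 !permM.
Qed.

(* The semidirect product of VPplus by 'S_n; as permutations compose from left
   to right, perm_act is a right action, hence the inverse in the product. *)
Definition flat_model : Type := (VPplus * 'S_n)%type.
HB.instance Definition _ := Choice.on flat_model.

Definition fm_mul (x y : flat_model) : flat_model := (x.1 * perm_act x.2^-1 y.1, x.2 * y.2).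
Definition fm_inv (x : flat_model) : flat_model := ((perm_act x.2 x.1)^-1, x.2^-1).
Definition fm_one : flat_model := (1, 1).

Fact fm_mulA : associative fm_mul.
Proof.
move=> x y z; rewrite /fm_mul /=; congr pair; last by rewrite mulgA.
by rewrite perm_actM mulgA invgM perm_actA.
Qed.
Fact fm_mul1g : left_id fm_one fm_mul.
Proof. by case=> x s; rewrite /fm_mul /= invg1 perm_act_id !mul1g. Qed.
Fact fm_mulg1 : right_id fm_one fm_mul.
Proof. by case=> x s; rewrite /fm_mul /= perm_act1 !mulg1. Qed.
Fact fm_mulVg : left_inverse fm_one fm_inv fm_mul.
Proof. by case=> x s; rewrite /fm_mul /fm_inv /= invgK !mulVg. Qed.
Fact fm_mulgV : right_inverse fm_one fm_inv fm_mul.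
Proof.
by case=> x s; rewrite /fm_mul /fm_inv /= perm_actV -perm_actA mulgV perm_act_id !mulgV.
Qed.

HB.instance Definition _ := isGroup.Build flat_model
  fm_mulA fm_mul1g fm_mulg1 fm_mulVg fm_mulgV.

End FlatModel.

(** * The embedding of VPplus into VP *)

Section Theta.
Variable n : nat.
Local Notation VB := (VB n).
Local Notation VPplus := (VPplus n).
Local Notation model := (flat_model n).

Definition lpoint (i : 'I_n.-1) : 'I_n := Ordinal (ltn_pred_l i).
Definition rpoint (i : 'I_n.-1) : 'I_n := Ordinal (ltn_pred_r i).

Lemma fm_mulE x s y t : ((x, s) : model) * (y, t) = (x * perm_act s^-1 y, s * t).
Proof. by []. Qed.

Lemma adj_tpermV (i : 'I_n.-1) : (adj_tperm i)^-1 = adj_tperm i.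
Proof. exact: tpermV. Qed.

Lemma adj_tpermL i : adj_tperm i (lpoint i) = rpoint i. Proof. exact: tpermL. Qed.
Lemma adj_tpermR i : adj_tperm i (rpoint i) = lpoint i. Proof. exact: tpermR. Qed.
Lemma adj_tpermD (i : 'I_n.-1) (x : 'I_n) : x != i :> nat -> x != i.+1 :> nat -> adj_tperm i x = x.
Proof. by move=> xi xi1; rewrite /adj_tperm tpermD // -val_eqE /= eq_sym. Qed.

(** The equation $\lambda_{i,i+1}=\rho_i\sigma_i^{-1}$ gives $\sigma_i=\lambda_{i,i+1}^{-1}\rho_i$,
    hence the reversed order of the two points. *)
Definition theta_gen (a : VB_gen n) : model :=
  match a with
  | inl i => (lambda2 (rpoint i) (lpoint i), adj_tperm i)
  | inr i => (1, adj_tperm i)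
  end.

Definition theta : VB -> model := quot_lift (word_eval theta_gen).

(** Tabulates two neighbouring transpositions on the three points that they move, so that the
    relations in [theta_gen_rel] can be checked by rewriting. *)
Lemma adj_tperm_points (i j : 'I_n.-1) : j = i.+1 :> nat -> exists a b c : 'I_n,
  [/\ uniq [:: a; b; c], [/\ lpoint i = a, rpoint i = b, lpoint j = b & rpoint j = c],
      [/\ adj_tperm i a = b, adj_tperm i b = a & adj_tperm i c = c] &
      [/\ adj_tperm j a = a, adj_tperm j b = c & adj_tperm j c = b]].
Proof.
move=> ji; exists (lpoint i), (rpoint i), (rpoint j).
have rij : rpoint i = lpoint j by apply: val_inj; rewrite /= ji.
split; first by rewrite /= !inE -!val_eqE /=; lia.
- by [].
- by rewrite adj_tpermL adj_tpermR adj_tpermD //= ji; lia.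
- by rewrite rij adj_tpermL adj_tpermR adj_tpermD //= ji; lia.
Qed.

(** In the first components, the braid relation of the $\sigma$'s becomes [lambda2_braid] for the
    indices [c], [b], [a], and their far commutation becomes [lambda2_commute]. In the mixed
    relation the permutation carries $\lambda_{ba}$ to $\lambda_{cb}$. *)
Lemma theta_gen_rel u v : VB_rel u v -> word_eval theta_gen u = word_eval theta_gen v.
Proof.
have farD (i j : 'I_n.-1) : far i j ->
    (adj_tperm i (lpoint j) = lpoint j) * (adj_tperm i (rpoint j) = rpoint j).
  by rewrite /far => ij; split; apply: adj_tpermD => /=; lia.
case=> {u v} [i j ij|i j ij|i j ij|i j ij|i|i j ij|i j ij];
  rewrite !word_evalM ?word_eval_letter; cbv beta iota delta [theta_gen].
- have [a [b [c [abc [-> -> -> ->] [sa sb sc] [ta tb tc]]]]] := adj_tperm_points ij.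
  rewrite !fm_mulE adj_tperm_braid // !invgM !adj_tpermV !perm_act_lambda2 !permM.
  rewrite !(sa, sb, sc, ta, tb, tc); congr pair; apply: esym.
  rewrite -[LHS]mulgA; apply: lambda2_braid.
  by move: abc; rewrite /= !inE -!val_eqE /=; lia.
- have ji : far j i by rewrite /far orbC.
  rewrite !fm_mulE !adj_tpermV !perm_act_lambda2 !(farD _ _ ij) !(farD _ _ ji) adj_tperm_far //.
  congr pair; apply: lambda2_commute.
  by move: ij; rewrite /far /= !inE -!val_eqE /=; lia.
- by rewrite !fm_mulE !perm_act1 !mulg1 adj_tperm_braid.
- by rewrite !fm_mulE !perm_act1 adj_tperm_far.
- by rewrite !fm_mulE !perm_act1 mulg1 -{1}adj_tpermV mulVg /word_eval big_nil.
- have ji : far j i by rewrite /far orbC.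
  rewrite !fm_mulE !perm_act1 mulg1 mul1g adj_tpermV perm_act_lambda2 !(farD _ _ ji).
  by rewrite adj_tperm_far.
have [a [b [c [abc [-> -> -> ->] [sa sb sc] [ta tb tc]]]]] := adj_tperm_points ij.
rewrite !fm_mulE adj_tperm_braid // !perm_act1 !mulg1 mul1g invgM !adj_tpermV perm_act_lambda2.
by rewrite !permM !(sa, sb, sc, ta, tb, tc).
Qed.

Lemma thetaM : {morph theta : x y / x * y}.
Proof. exact: presented_liftM theta_gen_rel. Qed.

Lemma thetaV : {morph theta : x / x^-1}.
Proof. exact: mulmorphV thetaM. Qed.

Lemma theta_sigma i : theta (sigma i) = (lambda2 (rpoint i) (lpoint i), adj_tperm i).
Proof. exact: presented_liftE theta_gen_rel (inl i). Qed.

Lemma theta_rho i : theta (rho i) = (1, adj_tperm i).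
Proof. exact: presented_liftE theta_gen_rel (inr i). Qed.

(** The transposition turns $\lambda_{i+1,i}$ into its inverse $\lambda_{i,i+1}$, so the square of
    the image of $\sigma_i$ is trivial. *)
Lemma theta_flat x y : flat_rel x y -> theta x = theta y.
Proof.
case=> i; rewrite thetaM theta_sigma fm_mulE adj_tpermV perm_act_lambda2.
rewrite adj_tpermL adj_tpermR -{2}adj_tpermV mulgV -(lambda2V (rpoint i)) mulgV.
by rewrite (mulmorph1 thetaM).
Qed.

Lemma theta_lamn (i j : 'I_n) : i < j -> theta (lamn n i j) = (lambda2 i j, 1).
Proof.
move=> ij; have [d Dj] : exists d, j = i + d.+1 :> nat by exists (j - i.+1); lia.
rewrite /lamn (_ : j - i.+1 = d); last lia.
have jn := ltn_ord j.
elim: d j Dj {ij} jn => [|d IHd] j Dj jn /=.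
  have i_n : i < n.-1 by lia.
  have [k Di] : exists k, i = lpoint k by exists (Ordinal i_n); apply: val_inj.
  have -> : j = rpoint k by apply: val_inj; rewrite /= Dj addn1 Di.
  rewrite Di -[rhon n _]/(rhon n k) -[sigman n _]/(sigman n k) rhonE sigmanE.
  rewrite thetaM thetaV theta_sigma theta_rho -[_^-1]/(fm_inv _) fm_mulE.
  by rewrite mul1g perm_actV -perm_actA /= !mulgV perm_act_id lambda2V.
have k_n : i + d.+1 < n.-1 by lia.
have -> : rhon n (i + d.+1) = rho (Ordinal k_n) by rewrite -rhonE.
have -> : j = rpoint (Ordinal k_n) by apply: val_inj; rewrite /= Dj addnS.
rewrite conjgE !thetaM thetaV theta_rho (IHd (lpoint (Ordinal k_n))) //.
rewrite -[_^-1]/(fm_inv _) /fm_inv perm_act1 invg1 !fm_mulE perm_act1 invgK mulg1 mul1g.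
rewrite perm_act_lambda2 adj_tpermL adj_tpermD ?mul1g ?mulVg //=; lia.
Qed.

(** * The homomorphism from $VP_n^+$ to $VP_n$ and its image *)

Definition lambda_gen (p : VPplus_gen n) : VP n := lambda (proj2_sig p).

Lemma lambda_gen_rel u v : VPplus_rel u v -> word_eval lambda_gen u = word_eval lambda_gen v.
Proof.
case=> [i j k l ij kl ijkl | k i j ki ij kj]; apply: val_inj;
  rewrite !word_evalM !word_eval_letter !valM /= !lambda_VBE.
  apply: lamn_commute; rewrite ?ij ?kl ?ltn_ord //.
by rewrite lamn_triple ?ki ?ij.
Qed.

Definition VPplus_VP : VPplus -> VP n := quot_lift (word_eval lambda_gen).

Lemma VPplus_VPM : {morph VPplus_VP : x y / x * y}.
Proof. exact: presented_liftM lambda_gen_rel. Qed.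

HB.instance Definition _ := isMultiplicative.Build VPplus (VP n) VPplus_VP VPplus_VPM.

Lemma VPplus_VPE (i j : 'I_n) (ij : i < j) : VPplus_VP (lambda_plus ij) = lambda ij.
Proof. exact: presented_liftE lambda_gen_rel (VPplus_letter ij). Qed.

Definition VPplus_VB (x : VPplus) : VB := val (VPplus_VP x).

Lemma VPplus_VBM : {morph VPplus_VB : x y / x * y}.
Proof. by move=> x y; rewrite /VPplus_VB VPplus_VPM valM. Qed.

Lemma VPplus_VBE (i j : 'I_n) : i < j -> VPplus_VB (lambda2 i j) = lamn n i j.
Proof. by move=> ij; rewrite (lambda2E ij) /VPplus_VB VPplus_VPE /= lambda_VBE. Qed.

(** It suffices to compare generators. The first component of [theta] thus recovers [x], which gives
    injectivity into $VP_n$ and, by [theta_flat], into $FVP_n$. *)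
Lemma theta_VPplus x : theta (VPplus_VB x) = (x, 1).
Proof.
move: x; apply: (@VPplus_hom_eq _ _ (theta \o VPplus_VB) (fun x => (x, 1))).
- by move=> x y /=; rewrite VPplus_VBM thetaM.
- by move=> x y; rewrite fm_mulE invg1 perm_act_id mulg1.
by move=> i j ij /=; rewrite -(lambda2E ij) VPplus_VBE ?theta_lamn.
Qed.

Lemma range_VPplus_VP : range VPplus_VP = subgroup_generated
  [set x : VP n | exists (i j : 'I_n) (ij : (i < j)%N), x = lambda ij].
Proof.
apply/seteqP; split=> [_ [x _ <-] S [[S1 SV] Sgen] | x].
  have SM y z : S y -> S z -> S (y * z).
    by move=> Sy Sz; rewrite -[z]invgK; apply: (SV) => //; rewrite -[_^-1]mul1g; apply: SV.
  elim/presented_ind: x => [|[[i j] ij] x Sx|[[i j] ij] x Sx].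
  - by rewrite (mulmorph1 VPplus_VPM).
  - by rewrite VPplus_VPM; apply: SM (Sx); apply: Sgen; exists i, j, ij; apply: VPplus_VPE.
  rewrite VPplus_VPM (mulmorphV VPplus_VPM) -[_^-1]mul1g; apply: SM (Sx); apply: SV => //.
  by apply: Sgen; exists i, j, ij; apply: VPplus_VPE.
apply; split=> [|_ [i [j [ij ->]]]]; last by exists (lambda_plus ij) => //; apply: VPplus_VPE.
split=> [|_ _ [y _ <-] [z _ <-]]; first by exists 1 => //; apply: mulmorph1 VPplus_VPM.
by exists (y * z^-1) => //; rewrite VPplus_VPM (mulmorphV VPplus_VPM).
Qed.

End Theta.

(** * The isomorphism with FVP *)

Section Flat.
Variable n : nat.
Local Notation VPplus := (VPplus n).
Local Notation flat := (quot_pi (@flat_rel n)).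

Lemma flat_sigmaV i : (flat (sigma i))^-1 = flat (sigma i).
Proof.
apply: (@mulgI _ (flat (sigma i))).
by rewrite mulgV -quot_piM; apply/esym/quot_piP/cong_rel/flat_sigma.
Qed.

Lemma flat_rhoV i : (flat (rho i))^-1 = flat (rho i).
Proof. by rewrite -quot_piV -rhonE rhonV. Qed.

Lemma flat_rho_sq i : flat (rho i) * flat (rho i) = 1.
Proof. by rewrite -{1}flat_rhoV mulVg. Qed.

(** For the pair $(k,k+1)$, conjugation gives $\sigma_k^{-1}\rho_k$ and the action gives
    $(\rho_k\sigma_k^{-1})^{-1}=\sigma_k\rho_k$; these agree because $\sigma_k^2=1$ in $FVB_n$. The
    other pairs are handled by [lamn_conj], already in $VB_n$. *)
Lemma conj_rho_VPplus k x :
  flat (VPplus_VB x) ^ flat (rho k) = flat (VPplus_VB (perm_act (adj_tperm k) x)).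
Proof.
move: x; apply: (@VPplus_hom_eq _ _ (fun x => flat (VPplus_VB x) ^ flat (rho k))
    (fun x => flat (VPplus_VB (perm_act (adj_tperm k) x)))) => [x y|x y|i j ij].
- by rewrite VPplus_VBM quot_piM conjMg.
- by rewrite perm_actM VPplus_VBM quot_piM.
rewrite -(lambda2E ij) perm_act_lambda2 VPplus_VBE //.
have [[Di Dj] | nij] := eqVneq (i : nat, j : nat) (k : nat, k.+1).
  have -> : i = lpoint k by apply: val_inj.
  have -> : j = rpoint k by apply: val_inj.
  rewrite adj_tpermL adj_tpermR -lambda2V (mulmorphV (@VPplus_VBM n)) quot_piV VPplus_VBE //=.
  rewrite /lamn subnn /= rhonE sigmanE !quot_piM !quot_piV flat_sigmaV invgM.
  by rewrite conjgE !flat_rhoV flat_sigmaV !mulgA flat_rho_sq mul1g.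
have swapij : adj_tperm k i < adj_tperm k j.
  move: nij; rewrite xpair_eqE !adj_tpermE /swapn.
  by do !case: eqP; lia.
rewrite VPplus_VBE // !adj_tpermE -lamn_conj ?ij ?ltn_ord //.
by rewrite -rhonE !conjgE !quot_piM quot_piV.
Qed.

(** Such products are stable under left multiplication by the generators: $\rho_i$ passes the first
    factor by [conj_rho_VPplus], and $\sigma_i=\lambda_{i,i+1}^{-1}\rho_i$. Every generator is its
    own inverse here. *)
Lemma FVB_decomp (y : FVB n) : exists x s,
  all (ltn^~ n.-1) s /\ y = flat (VPplus_VB x) * flat (rho_prod n s).
Proof.
pose P (y : FVB n) := exists x s,
  all (ltn^~ n.-1) s /\ y = flat (VPplus_VB x) * flat (rho_prod n s).
have Prho i z : P z -> P (flat (rho i) * z).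
  case=> x [s [sn ->]]; exists (perm_act (adj_tperm i) x), ((i : nat) :: s).
  rewrite /= ltn_ord -conj_rho_VPplus conjgE flat_rhoV.
  rewrite /rho_prod big_cons rhonE quot_piM -!mulgA (mulgA (flat (rho i)) (flat (rho i))).
  by rewrite flat_rho_sq mul1g.
have PVPplus x z : P z -> P (flat (VPplus_VB x) * z).
  case=> x' [s [sn ->]]; exists (x * x'), s; split=> //.
  by rewrite VPplus_VBM quot_piM mulgA.
have Psigma i z : P z -> P (flat (sigma i) * z).
  move=> Pz; have -> : flat (sigma i) =
      flat (VPplus_VB (lambda2 (rpoint i) (lpoint i))) * flat (rho i).
    rewrite -lambda2V (mulmorphV (@VPplus_VBM n)) VPplus_VBE //= /lamn subnn /=.
    by rewrite rhonE sigmanE invgM invgK -quot_piM mulgVK.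
  by rewrite -mulgA; apply/PVPplus/Prho.
elim/quot_ind: y => z; rewrite -[_ z]mulg1 -/(P _).
have P1 : P 1 by exists 1, [::]; rewrite (mulmorph1 (@VPplus_VBM n)) /rho_prod big_nil mulg1.
elim/presented_ind: z => [|[i|i] z IHz|[i|i] z IHz]; first by rewrite mul1g.
- by rewrite quot_piM -mulgA; apply: Psigma.
- by rewrite quot_piM -mulgA; apply: Prho.
- by rewrite quot_piM -mulgA quot_piV flat_sigmaV; apply: Psigma.
- by rewrite quot_piM -mulgA quot_piV flat_rhoV; apply: Prho.
Qed.

Lemma VPplus_FVB_ker x : flat (VPplus_VB x) \in ker_pred (@FVB_perm n).
Proof. by rewrite unfold_in /ker_pred /= FVB_perm_pi; apply: (valP (VPplus_VP x)). Qed.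

Definition VPplus_FVP (x : VPplus) : FVP n := Ker (VPplus_FVB_ker x).

Lemma VPplus_FVPM : {morph VPplus_FVP : x y / x * y}.
Proof. by move=> x y; apply: val_inj; rewrite valM /= VPplus_VBM quot_piM. Qed.

HB.instance Definition _ := isMultiplicative.Build VPplus (FVP n) VPplus_FVP VPplus_FVPM.

Lemma VPplus_FVP_inj : injective VPplus_FVP.
Proof.
move=> x y /(congr1 (fun z => quot_lift (@theta n) (val z))) /=.
by rewrite !(quot_liftE (@thetaM n) (@thetaV n) (@theta_flat n)) !theta_VPplus => -[].
Qed.

(** In the decomposition of [y] the first factor is pure, so the word in the $\rho_k$ has trivial
    permutation and is therefore trivial. *)
Lemma VPplus_FVP_surj (y : FVP n) : exists x, VPplus_FVP x = y.
Proof.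
have [x [s [sn Dy]]] := FVB_decomp (val y); exists x; apply: val_inj; rewrite /= Dy.
have : FVB_perm (val y) = 1 by apply/eqP/(valP y).
rewrite Dy FVB_permM (eqP (VPplus_FVB_ker x)) mul1g FVB_perm_pi => s1.
by rewrite (rho_prod_perm1 sn s1) mulg1.
Qed.

Lemma VPplus_FVP_bij : bijective VPplus_FVP.
Proof.
have [h hK] := choice VPplus_FVP_surj.
by exists h => // x; apply: VPplus_FVP_inj.
Qed.
End Flat.

Theorem proposition5p1 (n : nat) (hn : (0 < n)%N) :
  (exists f : {multiplicative VPplus n -> VP n},
     [/\ forall (i j : 'I_n) (ij : (i < j)%N), f (lambda_plus ij) = lambda ij,
         injective f &
         range f = subgroup_generated
           [set x : VP n | exists (i j : 'I_n) (ij : (i < j)%N), x = lambda ij]]) /\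
  (exists g : {multiplicative VPplus n -> FVP n}, bijective g).
Proof.
split; last by exists (@VPplus_FVP n); apply: VPplus_FVP_bij.
exists (@VPplus_VP n); split; [exact: VPplus_VPE | | exact: range_VPplus_VP].
(* Applying [theta] returns [(x, 1)] and [(y, 1)]. *)
move=> x y /(congr1 (fun z => theta (val z))).
by rewrite -![val _]/(VPplus_VB _) !theta_VPplus => -[].
Qed.
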